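(* Let $n\ge 1$. The number of distinct interval posets $P(\pi)$ with $\pi$ ranging over the block-wise simple permutations in $\mathcal{S}_n$ is equal to the number of ways to place non-crossing diagonals in a convex $(n+1)$-gon such that no triangles or quadrilaterals are present.
   Context: For $\pi=a_1\cdots a_n\in\mathcal{S}_n$, an interval (block) of $\pi$ is a non-empty contiguous sequence of entries $a_ia_{i+1}\cdots a_{i+k}$ whose values form a contiguous set of integers $[a,b]$; intervals are identified with their value sets. The interval poset $P(\pi)$ is the set of all non-empty intervals of $\pi$, ordered by inclusion; two interval posets are the same when they consist of the same family of intervals. For permutations $p_1\in\mathcal{S}_k$, $p_2\in\mathcal{S}_m$ ($k,m\ge1$), the direct sum $p_1\oplus p_2\in\mathcal{S}_{k+m}$ is $p_1$ followed by $p_2$ with all values shifted up by $k$, and the skew sum $p_1\ominus p_2$ is $p_1$ with values shifted up by $m$ followed by $p_2$. A permutation $\pi$ is block-wise simple if it has no interval whose pattern (the permutation obtained by order-isomorphically relabeling its entries) is of the form $p_1\oplus p_2$ or $p_1\ominus p_2$. A triangle (resp. quadrilateral) is present in a placement of non-crossing diagonals if some region into which the diagonals cut the polygon is bounded by exactly three (resp. four) segments, each a side of the polygon or a chosen diagonal. *)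

(* Defs.v *)
From HB Require Import structures.
From mathcomp Require Import all_boot all_fingroup.

Set Implicit Arguments.
Unset Strict Implicit.
Unset Printing Implicit Defensive.

(* Positions and values are numbered from 0: p : 'S_n stands for the word
   p 0, ..., p (n - 1) on the letters 0, ..., n - 1. *)

Definition contiguous n (A : {set 'I_n}) : bool :=
  [exists a : 'I_n, exists b : 'I_n,
     (a <= b) && (A == [set x : 'I_n | a <= x <= b])].

(* Intervals are given by their value sets, so p @^-1: V is the set of
   positions occupied by V. *)
Definition interval n (p : 'S_n) (V : {set 'I_n}) : bool :=
  contiguous (p @^-1: V) && contiguous V.

Definition interval_poset n (p : 'S_n) : {set {set 'I_n}} :=
  [set V | interval p V].

(* The entries of p with value in V, read from left to right. *)
Definition entries n (p : 'S_n) (V : {set 'I_n}) : seq nat :=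
  [seq val (p i) | i <- enum 'I_n & p i \in V].

Definition is_pattern (w : seq nat) k (s : 'S_k) : bool :=
  (size w == k) &&
  [forall i : 'I_k, forall j : 'I_k,
     (s i < s j) == (nth 0 w i < nth 0 w j)].

Section Sums.
Variables (k m : nat) (p1 : 'S_k) (p2 : 'S_m).

Definition dsum_fun (i : 'I_(k + m)) : 'I_(k + m) :=
  match split i with
  | inl a => lshift m (p1 a)
  | inr b => rshift k (p2 b)
  end.

Definition ssum_fun (i : 'I_(k + m)) : 'I_(k + m) :=
  match split i with
  | inl a => cast_ord (addnC m k) (rshift m (p1 a))
  | inr b => cast_ord (addnC m k) (lshift k (p2 b))
  end.

Lemma dsum_inj : injective dsum_fun.
Proof.
move=> i j; rewrite /dsum_fun.
case: (split_ordP i) => a ->; case: (split_ordP j) => b -> //.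
- by move=> /lshift_inj /perm_inj ->.
- by move/eqP; rewrite eq_lrshift.
- by move/eqP; rewrite eq_rlshift.
- by move=> /rshift_inj /perm_inj ->.
Qed.

Lemma ssum_inj : injective ssum_fun.
Proof.
move=> i j; rewrite /ssum_fun.
case: (split_ordP i) => a ->; case: (split_ordP j) => b -> // /cast_ord_inj.
- by move=> /rshift_inj /perm_inj ->.
- by move/eqP; rewrite eq_rlshift.
- by move/eqP; rewrite eq_lrshift.
- by move=> /lshift_inj /perm_inj ->.
Qed.

Definition direct_sum : 'S_(k + m) := perm dsum_inj.
Definition skew_sum : 'S_(k + m) := perm ssum_inj.

End Sums.

(* The bound on k and m only serves decidability, see block_wise_simpleP. *)
Definition block_wise_simple n (p : 'S_n) : bool :=
  [forall V in interval_poset p, forall k : 'I_n.+1, forall m : 'I_n.+1,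
     (0 < k) && (0 < m) ==>
     ~~ [exists p1 : 'S_k, exists p2 : 'S_m,
           is_pattern (entries p V) (direct_sum p1 p2)
           || is_pattern (entries p V) (skew_sum p1 p2)]].

Lemma block_wise_simpleP n (p : 'S_n) :
  reflect
    (forall V, V \in interval_poset p ->
     forall (k m : nat) (p1 : 'S_k) (p2 : 'S_m), 0 < k -> 0 < m ->
       ~ (is_pattern (entries p V) (direct_sum p1 p2)
          \/ is_pattern (entries p V) (skew_sum p1 p2)))
    (block_wise_simple p).
Proof.
apply: (iffP forall_inP) => [H V VP k m p1 p2 k0 m0 Hp|H V VP].
  have le_km : k + m <= n.
    have /eqP <- : size (entries p V) == k + m by case: Hp => /andP[].
    rewrite size_map (leq_trans (size_subseq (filter_subseq _ _))) //.
    by rewrite -cardE card_ord.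
  have kn : k < n.+1 by rewrite ltnS (leq_trans (leq_addr m k)).
  have mn : m < n.+1 by rewrite ltnS (leq_trans (leq_addl k m)).
  have /forallP/(_ (Ordinal kn))/forallP/(_ (Ordinal mn)) := H V VP.
  rewrite /= k0 m0 /= => /existsP; apply.
  by exists p1; apply/existsP; exists p2; apply/orP.
apply/forallP => k; apply/forallP => m; apply/implyP => /andP[k0 m0].
apply/existsP => -[p1 /existsP[p2 /orP Hp]].
exact: H Hp.
Qed.

(* A convex N-gon has vertex set 'I_N, numbered in cyclic order.  A segment
   between two vertices is the 2-element set of its end points, and a
   sub-polygon (the convex hull of some of the vertices) is its vertex set. *)

(* The line through the end points of the segment e has vertices in F strictly
   on both sides.  For two segments, separates d e says that d and e cross. *)
Definition separates N (e F : {set 'I_N}) : bool :=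
  [exists i in e, exists j in e, exists x in F, exists y in F,
     (i < x < j) && ((y < i) || (j < y))].

Definition sides N (F : {set 'I_N}) : {set {set 'I_N}} :=
  [set e : {set 'I_N} | [&& #|e| == 2, e \subset F & ~~ separates e F]].

Definition diagonals N : {set {set 'I_N}} :=
  [set e : {set 'I_N} | (#|e| == 2) && (e \notin sides [set: 'I_N])].

Definition noncrossing N (D : {set {set 'I_N}}) : bool :=
  (D \subset diagonals N) &&
  [forall d in D, forall e in D, ~~ separates d e].

(* The regions cut out by D are the sub-polygons that are bounded by sides of
   the N-gon and elements of D and that no element of D cuts through. *)
Definition region N (D : {set {set 'I_N}}) (F : {set 'I_N}) : bool :=
  [&& 2 < #|F|, sides F \subset sides [set: 'I_N] :|: D
    & [forall d in D, ~~ separates d F]].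

Definition has_region_with N (D : {set {set 'I_N}}) (k : nat) : bool :=
  [exists F, region D F && (#|sides F| == k)].

Definition triangle_quadrilateral_free N (D : {set {set 'I_N}}) : bool :=
  ~~ has_region_with D 3 && ~~ has_region_with D 4.

(* Main.v *)
(* Number the vertices of the (n+1)-gon from 0 to n and draw the interval
   [a, b) of values as the segment {a, b}: singletons and the whole interval
   become sides of the polygon, crossing segments are overlapping intervals, and
   an interval with k children becomes a region with k + 1 sides.  A permutation
   is block-wise simple iff no interval [a, c) splits into intervals [a, b) and
   [b, c).  This implies that intervals do not overlap, and also excludes
   three children, since among three value-consecutive blocks filling a block two
   value-adjacent ones are adjacent in position.  Conversely, a laminar family
   whose internal nodes have at least four children is the interval poset of an
   iterated inflation of simple permutations. *)
Require Import Defs.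
From HB Require Import structures.
From mathcomp Require Import all_boot all_fingroup.
From mathcomp Require Import zify.

Set Implicit Arguments.
Unset Strict Implicit.
Unset Printing Implicit Defensive.

(** * Intervals of a permutation *)

Definition ivset n a b : {set 'I_n} := [set x : 'I_n | a <= x < b].

Lemma filter_iota_interval n a b : b <= n ->
  [seq i <- iota 0 n | a <= i < b] = iota a (b - a).
Proof.
move=> bn; apply: (irr_sorted_eq ltn_trans ltnn).
- by apply: sorted_filter; [exact: ltn_trans|exact: iota_ltn_sorted].
- exact: iota_ltn_sorted.
- by move=> i; rewrite mem_filter !mem_iota; lia.
Qed.

Lemma card_ivset n a b : b <= n -> #|ivset n a b| = b - a.
Proof.
move=> bn; rewrite -sum1_card.
rewrite (eq_bigl (fun i : 'I_n => a <= i < b)); last by move=> i; rewrite inE.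
rewrite -(big_mkord (fun i => a <= i < b) (fun=> 1)) sum1_count -size_filter.
by rewrite /index_iota subn0 filter_iota_interval // size_iota.
Qed.

Lemma contiguousP n (A : {set 'I_n}) :
  reflect (exists a b, a < b <= n /\ A = ivset n a b) (contiguous A).
Proof.
apply: (iffP existsP) => [[a /existsP[b /andP[ab /eqP->]]]|[a [b [/andP[ab bn] ->]]]].
  exists a, b.+1; split; first by rewrite ltnS ab ltn_ord.
  by apply/setP => x; rewrite !inE.
have an : a < n by lia.
have bn' : b.-1 < n by lia.
exists (Ordinal an); apply/existsP; exists (Ordinal bn') => /=.
apply/andP; split; first by lia.
by apply/eqP/setP => x; rewrite !inE; apply/idP/idP; lia.
Qed.

Lemma contiguous_convexP n (A : {set 'I_n}) :
  reflect ((exists x, x \in A) /\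
           forall x y z : 'I_n, x <= y <= z -> x \in A -> z \in A -> y \in A)
          (contiguous A).
Proof.
apply: (iffP existsP) => [[a /existsP[b /andP[ab /eqP->]]]|[[x0 x0A] convA]].
  split; first by exists a; rewrite inE leqnn.
  by move=> x y z; rewrite !inE; lia.
have [a aA amin] : exists2 a, a \in A & forall x, x \in A -> a <= x.
  by case: (@arg_minnP _ x0 (mem A) val x0A) => a aA amin; exists a.
have [b bA bmax] : exists2 b, b \in A & forall x, x \in A -> x <= b.
  by case: (@arg_maxnP _ x0 (mem A) val x0A) => b bA bmax; exists b.
exists a; apply/existsP; exists b; rewrite amin //=.
apply/eqP/setP => x; rewrite inE; apply/idP/idP => [xA|axb].
  by rewrite amin // bmax.
exact: convA axb _ _.
Qed.

(** The bounds make [a] and [b] determined by the value set, so intervals can be handled as pairs of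
    numbers. *)
Definition blk n (p : 'S_n) a b : bool :=
  (a < b <= n) && (ivset n a b \in interval_poset p).

Lemma interval_posetP n (p : 'S_n) V :
  reflect (exists a b, blk p a b /\ V = ivset n a b) (V \in interval_poset p).
Proof.
apply: (iffP idP) => [VP|[a [b [/andP[_ ?] ->]]] //].
have := VP; rewrite inE => /andP[_ /contiguousP[a [b [ab eqV]]]].
by exists a, b; rewrite /blk ab -eqV.
Qed.

Lemma blk_convexP n (p : 'S_n) a b :
  reflect (a < b <= n /\ forall i j k : 'I_n, i <= j <= k ->
             a <= p i < b -> a <= p k < b -> a <= p j < b)
          (blk p a b).
Proof.
apply: (iffP andP) => -[abn H]; split=> //.
  move: H; rewrite inE => /andP[/contiguous_convexP[_ H] _] i j k ijk.
  by have := H _ _ _ ijk; rewrite !inE.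
rewrite inE; apply/andP; split; last by apply/contiguousP; exists a, b.
apply/contiguous_convexP; split.
  have an : a < n by lia.
  by exists (p^-1 (Ordinal an))%g; rewrite !inE permKV /=; lia.
by move=> i j k; rewrite !inE; apply: H.
Qed.

Definition occupies n (p : 'S_n) a b s : Prop :=
  [/\ a < b <= n, s + (b - a) <= n
    & forall i : 'I_n, (a <= p i < b) = (s <= i < s + (b - a))].

Lemma blk_posP n (p : 'S_n) a b : reflect (exists s, occupies p a b s) (blk p a b).
Proof.
apply: (iffP idP) => [pab|[s [abn sn sE]]]; last first.
  by apply/blk_convexP; split=> // i j k ijk; rewrite !sE; lia.
case/andP: pab => abn; rewrite inE => /andP[/contiguousP[s [t [stn eqst]]] _].
have tE : t = s + (b - a).
  have := congr1 (fun A : {set _} => #|A|) eqst.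
  rewrite /= card_preimset; last exact: perm_inj.
  by rewrite !card_ivset; lia.
exists s; split=> //; first by lia.
by move=> i; rewrite -tE; move/setP/(_ i): eqst; rewrite !inE.
Qed.

(** Otherwise the entry at position [maxn s t] would have its value in two disjoint ranges. *)
Lemma occupies_disjoint n (p : 'S_n) a b c d s t :
  occupies p a b s -> occupies p c d t -> b <= c ->
  s + (b - a) <= t \/ t + (d - c) <= s.
Proof.
move=> [abn sn sE] [cdn tn tE] bc.
have [lt_st|] := ltnP (maxn s t) (minn (s + (b - a)) (t + (d - c))); last by lia.
have xn : maxn s t < n by lia.
by have := sE (Ordinal xn); have := tE (Ordinal xn); rewrite /=; lia.
Qed.

Lemma occupies_sub n (p : 'S_n) a b c d s t :
  occupies p a b s -> occupies p c d t -> a <= c -> d <= b ->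
  s <= t /\ t + (d - c) <= s + (b - a).
Proof.
move=> [abn sn sE] [cdn tn tE] ac db.
have xn : t < n by lia.
have yn : (t + (d - c)).-1 < n by lia.
have := sE (Ordinal xn); have := tE (Ordinal xn).
have := sE (Ordinal yn); have := tE (Ordinal yn); rewrite /=; lia.
Qed.

Lemma occupies_cat n (p : 'S_n) a b c s t :
  occupies p a b s -> occupies p b c t -> s + (b - a) = t \/ t + (c - b) = s ->
  blk p a c.
Proof.
move=> [abn sn sE] [bcn tn tE] adj; apply/blk_posP; exists (minn s t).
split; [lia|lia|move=> i].
have -> : (a <= p i < c) = (a <= p i < b) || (b <= p i < c) by lia.
by rewrite sE tE; case: adj; lia.
Qed.

(** * Patterns of blocks and sums *)

Definition word n (p : 'S_n) (i : nat) : nat :=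
  if insub i is Some i' then val (p i') else 0.

Lemma wordE n (p : 'S_n) (i : 'I_n) : word p i = p i.
Proof. by rewrite /word valK. Qed.

Lemma entriesE n (p : 'S_n) (V : {set 'I_n}) s t : t <= n ->
  (forall i, (p i \in V) = (s <= i < t)) ->
  entries p V = [seq word p i | i <- iota s (t - s)].
Proof.
move=> tn sE; rewrite /entries.
have -> : [seq val (p i) | i <- enum 'I_n & p i \in V]
        = map (word p) [seq val i | i <- enum 'I_n & p i \in V].
  by rewrite -map_comp; apply: eq_map => i /=; rewrite wordE.
congr map; rewrite (eq_filter (a2 := preim val (fun i => s <= i < t))) //.
rewrite -filter_map val_enum_ord.
exact: filter_iota_interval.
Qed.

Lemma block_pattern n (p : 'S_n) a b s k : s + k <= n -> b = a + k ->
  (forall i : 'I_n, (a <= p i < b) = (s <= i < s + k)) ->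
  exists q : 'S_k, forall i : 'I_k, word p (s + i) = a + q i.
Proof.
move=> skn -> sE.
have /fin_all_exists[f fE] : forall i : 'I_k, exists j : 'I_k, word p (s + i) = a + j.
  move=> i; have lt_i : s + i < n by have := ltn_ord i; lia.
  have := sE (Ordinal lt_i); rewrite -wordE /= => wE.
  have jk : word p (s + i) - a < k by have := ltn_ord i; lia.
  by exists (Ordinal jk) => /=; have := ltn_ord i; lia.
have f_inj : injective f.
  move=> i j fij; have := fE j; rewrite -fij -fE.
  have lt_i : s + i < n by have := ltn_ord i; lia.
  have lt_j : s + j < n by have := ltn_ord j; lia.
  rewrite -[s + i]/(val (Ordinal lt_i)) -[s + j]/(val (Ordinal lt_j)) !wordE.
  move=> /val_inj/perm_inj/(congr1 val) /= eqij; apply: val_inj => /=; lia.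
by exists (perm f_inj) => i; rewrite permE.
Qed.

Lemma perm_order_rank k (q : 'S_k) (i : 'I_k) : q i = #|[set j | q j < q i]| :> nat.
Proof.
have -> : [set j | q j < q i] = q @^-1: ivset k 0 (q i).
  by apply/setP => j; rewrite !inE.
by rewrite card_preimset ?card_ivset ?subn0 //; [exact: ltnW | exact: perm_inj].
Qed.

(** A value is the number of smaller values, so a permutation can be read off from its
    comparisons. *)
Lemma perm_order_inj k (q r : 'S_k) :
  (forall i j, (q i < q j) = (r i < r j)) -> q = r.
Proof.
move=> qr; apply/permP => i; apply: val_inj.
rewrite [LHS]perm_order_rank [RHS]perm_order_rank.
by congr #|pred_of_set _|; apply/setP => j; rewrite !inE qr.
Qed.

Lemma direct_sum_lshift k m (p1 : 'S_k) (p2 : 'S_m) i :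
  direct_sum p1 p2 (lshift m i) = p1 i :> nat.
Proof. by rewrite permE /dsum_fun -[lshift m i]/(unsplit (inl i)) unsplitK. Qed.

Lemma direct_sum_rshift k m (p1 : 'S_k) (p2 : 'S_m) i :
  direct_sum p1 p2 (rshift k i) = k + p2 i :> nat.
Proof. by rewrite permE /dsum_fun -[rshift k i]/(unsplit (inr i)) unsplitK. Qed.

Lemma skew_sum_lshift k m (p1 : 'S_k) (p2 : 'S_m) i :
  skew_sum p1 p2 (lshift m i) = m + p1 i :> nat.
Proof. by rewrite permE /ssum_fun -[lshift m i]/(unsplit (inl i)) unsplitK. Qed.

Lemma skew_sum_rshift k m (p1 : 'S_k) (p2 : 'S_m) i :
  skew_sum p1 p2 (rshift k i) = p2 i :> nat.
Proof. by rewrite permE /ssum_fun -[rshift k i]/(unsplit (inr i)) unsplitK. Qed.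

(** [is_pattern] only compares orders, but the values of a block, shifted down by [a], already form
    a permutation, and a permutation is determined by its order. *)
Lemma is_pattern_word n (p : 'S_n) a b s k (q : 'S_k) : s + k <= n -> b = a + k ->
  (forall i : 'I_n, (a <= p i < b) = (s <= i < s + k)) ->
  is_pattern (entries p (ivset n a b)) q <->
  forall i : 'I_k, word p (s + i) = a + q i.
Proof.
move=> skn bE sE.
have -> : entries p (ivset n a b) = [seq word p i | i <- iota s k].
  rewrite (@entriesE _ _ _ s (s + k)) // ?addKn // => i.
  by rewrite inE sE.
rewrite /is_pattern size_map size_iota eqxx /=.
have nthE (i : 'I_k) : nth 0 [seq word p i | i <- iota s k] i = word p (s + i).
  by rewrite (nth_map 0) ?size_iota // nth_iota.
split=> [/forallP qP|qE].
  have [r rE] := block_pattern skn bE sE.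
  suff -> : q = r by [].
  apply: perm_order_inj => i j.
  by have /forallP/(_ j)/eqP := qP i; rewrite !nthE !rE ltn_add2l.
apply/forallP => i; apply/forallP => j.
by rewrite !nthE !qE ltn_add2l.
Qed.

(** A sum pattern cuts a block, by position and by value at once, into two value-adjacent blocks.
    Conversely, two such blocks filling a third follow each other in position, and their order
    decides between direct and skew sum. *)
Lemma block_wise_simple_blkP n (p : 'S_n) :
  reflect (forall a b c, blk p a b -> blk p b c -> blk p a c -> False)
          (block_wise_simple p).
Proof.
apply: (iffP (block_wise_simpleP p)) => [bws a b c pab pbc pac | nosum V].
  have Vac : ivset n a c \in interval_poset p by case/andP: pac.
  have [s1 o1] := blk_posP _ _ _ pab; have [s2 o2] := blk_posP _ _ _ pbc.
  have [s o] := blk_posP _ _ _ pac.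
  have [ss1 ts1] := occupies_sub o o1 (leqnn a) ltac:(by case: o2; lia).
  have [ss2 ts2] := occupies_sub o o2 ltac:(by case: o1; lia) (leqnn c).
  have disj := occupies_disjoint o1 o2 (leqnn b).
  case: o1 o2 o => /andP[ab _] s1n s1E [/andP[bc _] s2n s2E] [/andP[ac cn] sn sE].
  have [q1 q1E] := block_pattern s1n (esym (subnKC (ltnW ab))) s1E.
  have [q2 q2E] := block_pattern s2n (esym (subnKC (ltnW bc))) s2E.
  (* The two position ranges are disjoint, lie in that of [[a, c)] and have the same total length,
     so they fill it in one of two orders. *)
  have [[{}ss1 s1s2]|[{}ss2 s2s1]] :
      (s = s1 /\ s1 + (b - a) = s2) \/ (s = s2 /\ s2 + (c - b) = s1).
    by case: disj => ?; [left|right]; lia.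
  - apply: (bws _ Vac _ _ q1 q2 _ _ (or_introl _)); rewrite ?subn_gt0 //.
    apply/(@is_pattern_word _ _ _ _ s); [lia|lia|move=> i; rewrite sE; lia|].
    move=> i; case: (split_ordP i) => j ->.
      by rewrite direct_sum_lshift -q1E ss1.
    by rewrite direct_sum_rshift /= addnA ss1 s1s2 q2E; lia.
  - apply: (bws _ Vac _ _ q2 q1 _ _ (or_intror _)); rewrite ?subn_gt0 //.
    apply/(@is_pattern_word _ _ _ _ s); [lia|lia|move=> i; rewrite sE; lia|].
    move=> i; case: (split_ordP i) => j ->.
      by rewrite skew_sum_lshift /= ss2 q2E; lia.
    by rewrite skew_sum_rshift /= addnA ss2 s2s1 q1E.
move=> /interval_posetP[a [c [pac ->]]] k m p1 p2 k0 m0 pat.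
have [s [/andP[ac cn] sn sE]] := blk_posP _ _ _ pac.
have size_km : c - a = k + m.
  have size_e : size (entries p (ivset n a c)) = c - a.
    rewrite (@entriesE _ _ _ s (s + (c - a))) // ?size_map ?size_iota ?addKn //.
    by move=> i; rewrite inE sE.
  by rewrite -size_e; case: pat => /andP[/eqP].
rewrite size_km in sE sn.
have cE : c = a + (k + m) by lia.
have splitE (i : 'I_n) : s <= i < s + (k + m) ->
    exists j : 'I_(k + m), i = s + j :> nat.
  move=> si; have j_lt : i - s < k + m by lia.
  by exists (Ordinal j_lt) => /=; lia.
case: pat => /(is_pattern_word _ sn cE sE) wE.
- apply: (nosum a (a + k) c) => //; apply/blk_posP.
    exists s; rewrite /occupies addKn; split; [lia|lia|].
    move=> i; have := sE i; case: (boolP (s <= i < s + (k + m))) => [|/=]; last by lia.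
    move=> /splitE[j ij]; rewrite -wordE ij wE.
    case: (split_ordP j) => l ->.
      by rewrite direct_sum_lshift /=; have := ltn_ord l; have := ltn_ord (p1 l); lia.
    by rewrite direct_sum_rshift /=; have := ltn_ord l; have := ltn_ord (p2 l); lia.
  exists (s + k); rewrite /occupies; have -> : c - (a + k) = m by lia.
  split; [lia|lia|].
  move=> i; have := sE i; case: (boolP (s <= i < s + (k + m))) => [|/=]; last by lia.
  move=> /splitE[j ij]; rewrite -wordE ij wE.
  case: (split_ordP j) => l ->.
    by rewrite direct_sum_lshift /=; have := ltn_ord l; have := ltn_ord (p1 l); lia.
  by rewrite direct_sum_rshift /=; have := ltn_ord l; have := ltn_ord (p2 l); lia.
(* In a skew sum the [m] lowest values come last, so the cut is at value [a + m] but at position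
   [s + k]. *)
- apply: (nosum a (a + m) c) => //; apply/blk_posP.
    exists (s + k); rewrite /occupies addKn; split; [lia|lia|].
    move=> i; have := sE i; case: (boolP (s <= i < s + (k + m))) => [|/=]; last by lia.
    move=> /splitE[j ij]; rewrite -wordE ij wE.
    case: (split_ordP j) => l ->.
      by rewrite skew_sum_lshift /=; have := ltn_ord l; have := ltn_ord (p1 l); lia.
    by rewrite skew_sum_rshift /=; have := ltn_ord l; have := ltn_ord (p2 l); lia.
  exists s; rewrite /occupies; have -> : c - (a + m) = k by lia.
  split; [lia|lia|].
  move=> i; have := sE i; case: (boolP (s <= i < s + (k + m))) => [|/=]; last by lia.
  move=> /splitE[j ij]; rewrite -wordE ij wE.
  case: (split_ordP j) => l ->.
    by rewrite skew_sum_lshift /=; have := ltn_ord l; have := ltn_ord (p1 l); lia.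
  by rewrite skew_sum_rshift /=; have := ltn_ord l; have := ltn_ord (p2 l); lia.
Qed.

Lemma blk_leaf n (p : 'S_n) i : i < n -> blk p i i.+1.
Proof.
move=> lt_in; apply/blk_posP.
pose j := (p^-1 (Ordinal lt_in))%g; exists j.
split; [by lia|by have := ltn_ord j; lia|].
move=> l; have -> : (i <= p l < i.+1) = (p l == Ordinal lt_in) by rewrite -val_eqE /=; lia.
rewrite (canF_eq (permK p)) -/j -val_eqE /=; lia.
Qed.

Lemma blk_root n (p : 'S_n) : 0 < n -> blk p 0 n.
Proof. by move=> n0; apply/blk_convexP; split=> [|i j k *]; [lia | exact: ltn_ord]. Qed.

(** * Permutations in which no interval splits into two intervals *)

Section NoSum.
Variables (n : nat) (p : 'S_n).
Hypothesis nosum : forall a b c, blk p a b -> blk p b c -> blk p a c -> False.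

(** If two intervals overlapped, the difference [[a, c)] and the union [[a, d)] would be intervals
    too, and with [[c, d)] they would violate [nosum]. *)
Lemma blk_laminar a b c d : blk p a b -> blk p c d -> a < c < b -> b < d -> False.
Proof.
move=> pab pcd acb bd; apply: (nosum (a := a) (b := c) (c := d)) => //.
all: case/blk_convexP: pab => abn pab; case/blk_convexP: (pcd) => cdn {}pcd.
all: apply/blk_convexP; split; first by lia.
- move=> i j k ijk pi pk.
  have bn : b < n by lia.
  (* The value [b] is in [[c, d)] but not in [[a, b)]. Wherever its position [w] lies, one of the
     two convexities forbids a value of [[c, b)] placed between two values of [[a, c)]. *)
  pose w := (p^-1 (Ordinal bn))%g; have pw : p w = b :> nat by rewrite permKV.
  have pj : a <= p j < b by apply: (pab i j k) => //; lia.
  have [//|cpj] := ltnP (p j) c; first by lia.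
  have [wi|iw] := ltnP w i; first by have := pcd w i j; rewrite pw; lia.
  have [wk|kw] := leqP w k; first by have := pab i w k; rewrite pw; lia.
  by have := pcd j k w; rewrite pw; lia.
- move=> i j k ijk pi pk.
  have cn : c < n by lia.
  (* The value [c] lies in both intervals, so its position [w] links their two convex sets of
     positions. *)
  pose w := (p^-1 (Ordinal cn))%g; have pw : p w = c :> nat by rewrite permKV.
  have [pib|bpi] := ltnP (p i) b.
    have [pkb|bpk] := ltnP (p k) b; first by have := pab i j k; lia.
    have [jw|wj] := leqP j w; first by have := pab i j w; rewrite pw; lia.
    by have := pcd w j k; rewrite pw; lia.
  have [cpk|pkc] := leqP c (p k); first by have := pcd i j k; lia.
  have [jw|wj] := leqP j w; first by have := pcd i j w; rewrite pw; lia.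
  by have := pab w j k; rewrite pw; lia.
Qed.

(** The block [[b, c)] has a neighbour in position among the other two, and each of these is
    adjacent to it in value, so the two unite to an interval. *)
Lemma blk_no_triple a b c d :
  blk p a b -> blk p b c -> blk p c d -> blk p a d -> False.
Proof.
move=> pab pbc pcd pad.
have /orP[pac|pbd] : blk p a c || blk p b d; last 2 first.
- exact: (nosum pab pbc).
- exact: (nosum pbc pcd).
have [s1 o1] := blk_posP _ _ _ pab; have [s2 o2] := blk_posP _ _ _ pbc.
have [s3 o3] := blk_posP _ _ _ pcd; have [s o] := blk_posP _ _ _ pad.
have [/andP[/andP[ab _] _] /andP[/andP[bc _] _]] := conj pab pbc.
have /andP[/andP[cd _] _] := pcd.
have [in1 in1'] := occupies_sub o o1 (leqnn a) ltac:(lia).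
have [in2 in2'] := occupies_sub o o2 ltac:(lia) ltac:(lia).
have [in3 in3'] := occupies_sub o o3 ltac:(lia) (leqnn d).
have disj12 := occupies_disjoint o1 o2 (leqnn b).
have disj23 := occupies_disjoint o2 o3 (leqnn c).
have disj13 := occupies_disjoint o1 o3 (ltnW bc).
have : (s1 + (b - a) = s2 \/ s2 + (c - b) = s1) \/
       (s2 + (c - b) = s3 \/ s3 + (d - c) = s2) by lia.
case=> adj; apply/orP; first by left; exact: occupies_cat o1 o2 adj.
by right; exact: occupies_cat o2 o3 adj.
Qed.

End NoSum.

(** * Realisation of laminar families *)

(* Position keys of the simple permutation 1 3 0 5 2 7 4 .. of length k, whose
   inversion graph is a path; the last key is adjusted when k is odd. *)
Definition oscillation k i : nat :=
  if odd i then i.-1 else if i.+1 == k then i else i + 3.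

Lemma oscillation_inj k i j : i < k -> j < k ->
  oscillation k i = oscillation k j -> i = j.
Proof. rewrite /oscillation; by move=> ik jk; repeat case: ifP; lia. Qed.

(** This is simplicity expressed by keys. The outside index [h] is found within distance two to the
    right of [j] if [j] is not last, and within distance three to the left of [i] otherwise. *)
Lemma oscillation_simple k i j : 4 <= k -> i < j < k -> (0 < i) || (j.+1 < k) ->
  exists x h z, [/\ i <= x <= j, i <= z <= j, (h < k) && ~~ (i <= h <= j)
    & oscillation k x < oscillation k h < oscillation k z].
Proof.
move=> k4 ijk.
case: (ltnP j.+1 k) => [jk _|jk]; last rewrite orbF.
  case: (boolP (odd j)) => oj.
  - have [jk2|jk2] := eqVneq j.+2 k.
      exists j, j.+1, j.-1; split; try lia.
      rewrite /oscillation; repeat case: ifP; lia.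
    exists j, j.+2, j.-1; split; try lia.
    rewrite /oscillation; repeat case: ifP; lia.
  - exists j.-1, j.+1, j; rewrite /oscillation; split; repeat case: ifP; lia.
move=> i0.
case: (boolP (odd i)) => oi.
- case: (ltnP i.+2 k) => ik.
    exists i, i.-1, i.+1; rewrite /oscillation; split; repeat case: ifP; lia.
  (* Here [k] is odd and the range consists of the last two indices. The lowered last key [k - 1]
     makes [i - 1] fail as [h]; [4 <= k] yields [3 <= i]. *)
  exists i, (i - 3), i.+1; rewrite /oscillation; split; repeat case: ifP; lia.
- exists i.+1, (i - 2), i; rewrite /oscillation; split; repeat case: ifP; lia.
Qed.

Lemma discrete_ivt (f : nat -> nat) x y h :
  (forall z, f z.+1 <= (f z).+1) -> x <= y -> f x <= h <= f y ->
  exists2 z, x <= z <= y & f z = h.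
Proof.
move=> fS xy; rewrite -(subnKC xy); elim: (y - x) => [|m IHm].
  by rewrite addn0 => fh; exists x; lia.
rewrite addnS => fh; have := fS (x + m); have [fm|fm] := leqP h (f (x + m)).
  by have [|z] := IHm; first lia; exists z; lia.
by exists (x + m).+1; lia.
Qed.

Section Realisation.
Variables (n : nat) (E : rel nat).
Hypothesis E_bound : forall a b, E a b -> a < b <= n.
Hypothesis E_leaf : forall i, i < n -> E i i.+1.
Hypothesis E_laminar : forall a b c d, E a b -> E c d -> a < c < b -> b < d -> False.
Hypothesis E_no2 : forall a b c, E a b -> E b c -> E a c -> False.
Hypothesis E_no3 : forall a b c d, E a b -> E b c -> E c d -> E a d -> False.

(* [pos] lists [a, b) in an order in which the sets [c, d) in E are exactly
   the contiguous ones. *)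
Definition keys a b (pos : nat -> nat) : Prop :=
  (forall x y, a <= x < b -> a <= y < b -> pos x = pos y -> x = y) /\
  (forall c d, a <= c -> c < d -> d <= b ->
     E c d <-> forall x y z, c <= x < d -> a <= y < b -> c <= z < d ->
               pos x < pos y < pos z -> c <= y < d).

(** * One node of the family and its children *)

Section Children.
Variables (a b : nat).
Hypotheses (Eab : E a b) (ab1 : a.+1 < b).

(* The end points of the maximal proper members of E inside [a, b). *)
Definition cut c : bool :=
  (a <= c <= b) && [forall x : 'I_b.+1, forall y : 'I_b.+1,
    [&& a <= x, x < c, c < y & E x y] ==> (x == a :> nat) && (y == b :> nat)].

Lemma cutP c : reflect (a <= c <= b /\ forall x y, a <= x -> x < c < y -> y <= b ->
   E x y -> x = a /\ y = b) (cut c).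
Proof.
apply: (iffP andP) => -[acb H]; split=> //.
  move=> x y ax xcy yb Exy.
  have xb : x < b.+1 by lia.
  have := forallP (forallP H (Ordinal xb)) (Ordinal (yb : y < b.+1)).
  by rewrite /= ax Exy; case/andP: xcy => -> -> /= /andP[/eqP-> /eqP->].
apply/forallP => x; apply/forallP => y; apply/implyP => /and4P[ax xc cy Exy].
by have [|->->] := H _ _ ax _ (ltn_ord y : y <= b) Exy; [rewrite xc cy|rewrite !eqxx].
Qed.

Lemma cut_left : cut a.
Proof. by apply/cutP; split; [lia | move=> x y; lia]. Qed.

Lemma cut_right : cut b.
Proof. by apply/cutP; split; [lia | move=> x y; lia]. Qed.

(** The next cut is the right end [d] of the longest proper member starting at [c]; the leaf at [c]
    shows that there is one. A member other than [[a, b)] straddling [d] would cross [[c, d)],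
    straddle the cut [c], or be a longer choice. *)
Lemma cut_next c : cut c -> c < b -> exists c', [/\ c < c' <= b, cut c', E c c',
   ~~ ((c == a) && (c' == b)) & forall x, c < x < c' -> ~~ cut x].
Proof.
move=> /cutP[acb cutc] cb; have bn := E_bound Eab.
pose Q d := [&& c < d, d <= b, E c d & ~~ ((c == a) && (d == b))].
have exQ : exists d, Q d.
  by exists c.+1; rewrite /Q E_leaf; lia.
have ubQ d : Q d -> d <= b by case/and4P.
case: (ex_maxnP exQ ubQ) => d /and4P[cd db Ecd neq] dmax.
exists d; split=> //; first by rewrite cd.
  apply/cutP; split; first by lia.
  move=> x y ax xdy yb Exy.
  have [cx|xc|xc] := ltngtP c x.
  - by have := E_laminar Ecd Exy; lia.
  - by apply: cutc Exy; lia.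
  - subst x; case: (boolP (Q y)) => [/dmax|]; first by lia.
    rewrite /Q Exy yb negb_and; lia.
move=> x cxd; apply/negP => /cutP[_ /(_ c d)].
have /andP[ac _] := acb; move=> /(_ ac cxd db Ecd) [ca dbE].
by move: neq; rewrite ca dbE !eqxx.
Qed.

(** Each cut in [(a, x]] starts a new child, so for [a <= x < b] this is the index, from 0, of the
    child containing [x]. As [b] is itself a cut, [child b] is the number of children. *)
Definition child x := count cut (iota a.+1 (x - a)).

Lemma child_left : child a = 0.
Proof. by rewrite /child subnn. Qed.

Lemma childS x : a <= x -> child x.+1 = child x + cut x.+1.
Proof.
move=> ax; rewrite /child (subSn ax) -(addn1 (x - a)) iotaD count_cat /= addn0.
by rewrite addSn (subnKC ax).
Qed.

Lemma child_le x y : x <= y -> child x <= child y.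
Proof.
by move=> xy; rewrite /child -(subnKC (leq_sub2r a xy)) iotaD count_cat leq_addr.
Qed.

Lemma child_eq x y : a <= x -> x <= y -> (forall z, x < z <= y -> ~~ cut z) ->
  child y = child x.
Proof.
move=> ax xy; rewrite -(subnKC xy); elim: (y - x) => [|m IHm] ncut.
  by rewrite addn0.
rewrite addnS childS; last by lia.
rewrite (negPf (ncut (x + m).+1 _)); last by lia.
by rewrite addn0 IHm // => z ?; apply: ncut; lia.
Qed.

Lemma child_lt x y : a <= x -> x < y -> cut y -> child x < child y.
Proof.
move=> ax; case: y => // y xy cy; rewrite childS; last by lia.
by rewrite cy addn1 ltnS child_le.
Qed.

Lemma child_ivt x y h : a <= x -> x <= y -> child x <= h <= child y ->
  exists2 z, x <= z <= y & child z = h.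
Proof.
move=> ax; apply: discrete_ivt => z.
have [az|za] := leqP a z; first by rewrite childS //; lia.
by rewrite /child; have -> : z.+1 - a = 0 by lia.
Qed.

Lemma child_right : child b.-1 = (child b).-1.
Proof.
have -> : child b = child b.-1 + 1.
  have := @childS b.-1; have -> : b.-1.+1 = b by lia.
  by move=> ->; rewrite ?cut_right //; lia.
by rewrite addn1.
Qed.

(** Children are proper, so the first cut [u] after [a] is not [b]; the second is not [b] by
    [E_no2], nor the third by [E_no3]. *)
Lemma child_count : 4 <= child b.
Proof.
have [|u [au cutu Eau nu _]] := cut_next cut_left; first by lia.
have ub : u < b by lia.
have [v [uv cutv Euv _ _]] := cut_next cutu ub.
have vb : v < b.
  have [|bv|vb] := ltngtP v b; [by []|lia|].
  by subst v; have := E_no2 Eau Euv Eab.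
have [w [vw cutw Evw _ _]] := cut_next cutv vb.
have wb : w < b.
  have [|bw|wb] := ltngtP w b; [by []|lia|].
  by subst w; have := E_no3 Eau Euv Evw Eab.
have := child_lt (leqnn a) _ cutu; have := @child_lt u v _ _ cutv.
have := @child_lt v w _ _ cutw; have := @child_lt w b _ _ cut_right; lia.
Qed.

(** The child starts at the least [c] of index [h], which is a cut since otherwise [c - 1] would
    have the same index; it ends at the next cut. *)
Lemma child_bounds h : h < child b -> exists c c',
  [/\ E c c', c' - c < b - a, a <= c, c' <= b &
   forall x, a <= x < b -> (child x == h) = (c <= x < c')].
Proof.
move=> hb.
have exQ : exists x, (a <= x) && (child x == h).
  have [||x ax xh] := @child_ivt a b h (leqnn a); rewrite ?child_left; try lia.
  by exists x; rewrite xh; lia.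
case: (ex_minnP exQ) => c /andP[ac /eqP ch] cmin.
have cb : c < b by rewrite ltnNge; apply/negP => /child_le; lia.
have cutc : cut c.
  have [->|neq] := eqVneq c a; first exact: cut_left.
  apply/negPn/negP => ncut.
  have := cmin c.-1; have := @childS c.-1; have -> : c.-1.+1 = c by lia.
  by rewrite (negPf ncut) addn0 => <-; rewrite ?ch ?eqxx; lia.
have [c' [cc' cutc' Ecc' neq ncut]] := cut_next cutc cb.
exists c, c'; split=> //; try lia.
move=> x axb; have [cx|xc] := leqP c x; last first.
  by apply/negP => xh; have := cmin x; rewrite xh; lia.
have [xc'|c'x] := leqP c' x => /=.
  have := @child_lt c c' _ _ cutc'; have := child_le xc'; lia.
apply/eqP; rewrite -ch; apply: child_eq => // z ?; apply: ncut; lia.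
Qed.

Lemma child_member c d : a <= c -> c < d -> d <= b -> E c d ->
  ~~ ((c == a) && (d == b)) -> child d.-1 = child c.
Proof.
move=> ac cd db Ecd neq; apply: child_eq; [by []|lia|].
move=> z czd; apply/negP => /cutP[_ /(_ c d)]; rewrite ac Ecd db.
by case=> //; [lia|move=> ca dbE; move: neq; rewrite ca dbE !eqxx].
Qed.

(** Inflation of a simple permutation: children are ordered by the oscillation of their index, and
    points of one child by the keys that induction gives for it. *)
Lemma keys_node :
  (forall c c', E c c' -> c' - c < b - a -> exists pos, keys c c' pos) ->
  exists pos, keys a b pos.
Proof.
move=> IH; set k := child b; have k4 := child_count; rewrite -/k in k4.
(* [loc h] expresses [keys] for child [h] through child indices instead of end points, so that keys
   can be chosen for all [h] at once. *)
pose loc h (pos : nat -> nat) :=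
  (forall x y, a <= x < b -> a <= y < b -> child x = h -> child y = h ->
     pos x = pos y -> x = y) /\
  (forall c d, a <= c -> c < d -> d <= b -> child c = h -> child d.-1 = h ->
     E c d <-> forall x y z, c <= x < d -> a <= y < b -> child y = h -> c <= z < d ->
               pos x < pos y < pos z -> c <= y < d).
have /fin_all_exists[f fP] : forall h : 'I_k, exists pos, loc h pos.
  move=> h; have [c [c' [Ecc' lt_cc' ac c'b memE]]] := child_bounds (ltn_ord h).
  have [pos [pos_inj posE]] := IH c c' Ecc' lt_cc'; exists pos; split.
    by move=> x y xb yb /eqP xh /eqP yh; apply: pos_inj; rewrite -memE.
  move=> u v au uv vb uh vh.
  have cu : c <= u < c' by rewrite -memE ?uh ?eqxx //; lia.
  have cv : c <= v.-1 < c' by rewrite -memE ?vh ?eqxx //; lia.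
  rewrite posE; try lia; split=> H x y z xuv yb.
    by move=> /eqP yh; apply: H => //; rewrite -memE.
  by apply: H => //; [lia | apply/eqP; rewrite memE; lia].
pose g h := if insub h is Some h' then f h' else id.
have gP h : h < k -> loc h (g h).
  by move=> hk; rewrite /g insubT; exact: (fP (Ordinal hk)).
(* [M] exceeds every local key, so [pos] below compares lexicographically: first the keys of the
   children, then the keys inside a child. *)
pose M := (\max_(h < k) \max_(x < b) g h x).+1.
have gM h x : h < k -> x < b -> g h x < M.
  move=> hk xb; rewrite ltnS.
  rewrite (leq_trans _ (leq_bigmax (Ordinal hk))) //=.
  exact: (leq_bigmax (F := fun x : 'I_b => g h x) (Ordinal xb)).
pose s x := oscillation k (child x).
pose pos x := s x * M + g (child x) x.
have childk x : a <= x < b -> child x < k.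
  move=> axb; have := child_le (x := x) (y := b.-1); rewrite child_right -/k; lia.
have lex x y : a <= x < b -> a <= y < b -> s x < s y -> pos x < pos y.
  move=> xb yb sxy; rewrite /pos.
  apply: (@leq_trans (s x * M + M)); first by rewrite ltn_add2l gM ?childk //; lia.
  by rewrite addnC -mulSn (leq_trans _ (leq_addr _ _)) // leq_mul2r sxy orbT.
have s_inj x y : a <= x < b -> a <= y < b -> s x = s y -> child x = child y.
  by move=> xb yb; apply: oscillation_inj; exact: childk.
have pos_child x y z : a <= x < b -> a <= y < b -> a <= z < b ->
    child x = child z -> pos x < pos y < pos z -> child y = child x.
  move=> xb yb zb xz pxyz; apply: s_inj => //.
  have sxz : s x = s z by rewrite /s xz.
  have [lt_s|lt_s|//] := ltngtP (s y) (s x).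
    by have := lex _ _ yb xb lt_s; lia.
  by rewrite sxz in lt_s; have := lex _ _ zb yb lt_s; lia.
have pos_in x y : child x = child y -> (pos x < pos y) = (g (child x) x < g (child x) y).
  by move=> xy; rewrite /pos /s xy ltn_add2l.
exists pos; split.
  move=> x y xb yb pxy; have xy : child x = child y.
    apply: s_inj => //; have [lt_s|lt_s|//] := ltngtP (s x) (s y).
      by have := lex _ _ xb yb lt_s; lia.
    by have := lex _ _ yb xb lt_s; lia.
  have [g_inj _] := gP _ (childk _ xb); apply: g_inj => //.
  by apply/eqP; move: pxy; rewrite /pos /s xy => /eqP; rewrite eqn_add2l.
move=> c d ac cd db.
have c_in : a <= c < b by lia.
have d_in : a <= d.-1 < b by lia.
(* A range inside one child is governed by the local keys, since by [pos_child] only points of that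
   child come between its points. *)
have [same|diff] := eqVneq (child d.-1) (child c).
  have childV x : c <= x < d -> child x = child c.
    move=> xcd; have := child_le (x := c) (y := x); have := child_le (x := x) (y := d.-1); lia.
  have [_ gE] := gP _ (childk _ c_in).
  rewrite (gE c d ac cd db erefl same); split=> H x y z xcd yb.
    move=> zcd pxyz; have yc : child y = child c.
      by rewrite -(childV x) //; apply: (pos_child x y z) pxyz; rewrite ?childV //; lia.
    apply: (H x y z) => //; move: pxyz.
    by rewrite !pos_in ?yc ?childV.
  move=> yc zcd gxyz; apply: (H x y z) => //.
  by rewrite !pos_in ?yc ?childV.
(* The range now meets several children; a member of [E] doing so is [[a, b)] itself. *)
split=> [Ecd x y z xcd yb zcd _|conv].
  case: (boolP ((c == a) && (d == b))) => [/andP[/eqP-> /eqP->] //|neq].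
  by rewrite (child_member ac cd db Ecd neq) eqxx in diff.
case: (boolP ((c == a) && (d == b))) => [/andP[/eqP-> /eqP->] //|neq]; exfalso.
have lt_cd : child c < child d.-1.
  by have := child_le (x := c) (y := d.-1); lia.
have pick h : child c <= h <= child d.-1 -> exists2 z, c <= z < d & child z = h.
  have cd1 : c <= d.-1 by lia.
  by move=> /(child_ivt ac cd1)[z zcd zh]; exists z; first lia.
have break x h z y : child c <= x <= child d.-1 -> child c <= z <= child d.-1 ->
    oscillation k x < oscillation k h < oscillation k z ->
    a <= y < b -> child y = h -> ~~ (c <= y < d) -> False.
  move=> /pick[x' x'cd <-] /pick[z' z'cd <-] /andP[xh hz] yb yh /negP; apply.
  by apply: (conv x' y z') => //; apply/andP; split; apply: lex; rewrite /s ?yh //; lia.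
have jk := childk _ d_in.
(* If the first or the last child is missed, simplicity applied to the children met yields a missed
   child whose points break convexity. *)
case: (boolP ((0 < child c) || ((child d.-1).+1 < k))) => [sub|].
  have [|x [h [z [xP zP /andP[hk hP] xhz]]]] := oscillation_simple k4 _ sub.
    by rewrite lt_cd.
  have [||y yab yh] := @child_ivt a b.-1 h (leqnn a).
  - by lia.
  - by rewrite child_left child_right -/k; lia.
  apply: (break x h z y) => //; first by lia.
  apply: contra hP; rewrite -yh => ycd.
  by rewrite !child_le //; lia.
rewrite negb_or => /andP[c0 dk].
(* All children are met, but [a] or [b - 1] is missing. Simplicity for all indices but the first, or
   all but the last, forces [h] to be the omitted index, and the missing point lies in that
   child. *)
move: neq; rewrite negb_and => /orP[ca|dneq].
  have [||x [h [z [xP zP hP xhz]]]] := @oscillation_simple k 1 k.-1 k4; try lia.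
  by apply: (break x h z a) => //; rewrite ?child_left; lia.
have [||x [h [z [xP zP hP xhz]]]] := @oscillation_simple k 0 k.-2 k4; try lia.
by apply: (break x h z b.-1) => //; rewrite ?child_right -/k; lia.
Qed.

End Children.

Lemma keys_exist a b : E a b -> exists pos, keys a b pos.
Proof.
have [m] := ubnP (b - a); elim: m a b => // m IHm a b lt_m Eab.
have [ab1|ba1] := ltnP a.+1 b.
  by apply: keys_node => // c c' Ecc' lt_cc'; apply: IHm => //; lia.
have := E_bound Eab => abn.
exists id; split=> // c d ac cd db; have [-> ->] : c = a /\ d = b by lia.
by [].
Qed.

Lemma blk_realised : E 0 n -> exists p : 'S_n, forall a b, blk p a b = E a b.
Proof.
move=> /keys_exist[pos [pos_inj posE]].
pose below (x : 'I_n) := [set y : 'I_n | pos y < pos x].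
have rank_lt (x : 'I_n) : #|below x| < n.
  rewrite -[X in _ < X](card_ord n) -cardsT proper_card // properEneq subsetT andbT.
  by apply/eqP => /setP/(_ x); rewrite !inE ltnn.
have rankE (x y : 'I_n) : (#|below x| < #|below y|) = (pos x < pos y).
  have mono (u v : 'I_n) : pos u <= pos v -> #|below u| <= #|below v|.
    by move=> uv; apply/subset_leq_card/subsetP => w; rewrite !inE => /leq_trans; apply.
  apply/idP/idP => [|xy]; first by apply: contraLR; rewrite -!leqNgt; apply: mono.
  apply: proper_card; apply/properP; split.
    by apply/subsetP => w; rewrite !inE => /ltn_trans; apply.
  by exists x; rewrite !inE ?ltnn.
pose r x := Ordinal (rank_lt x).
have r_inj : injective r.
  move=> x y /(congr1 val) /= rxy; apply/val_inj/pos_inj; rewrite ?ltn_ord //.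
  have := rankE x y; have := rankE y x; rewrite rxy ltnn.
  by case: ltngtP.
(* [r] sends a value to its position, whereas [p] sends positions to values, hence the inverse. *)
exists (perm r_inj)^-1%g => a b.
have rE (i j : 'I_n) : (i < j) = (pos ((perm r_inj)^-1%g i) < pos ((perm r_inj)^-1%g j)).
  rewrite -rankE -[LHS]/(val i < val j).
  by rewrite -{1}[i](permKV (perm r_inj)) -{1}[j](permKV (perm r_inj)) !permE.
set p := (perm r_inj)^-1%g in rE *.
apply/blk_convexP/idP => [[abn conv]|Eab].
  apply/posE; try lia.
  move=> x y z xab yn zab /andP[xy yz].
  have xn : x < n by lia.
  have zn : z < n by lia.
  have := conv (p^-1 (Ordinal xn))%g (p^-1 (Ordinal yn))%g (p^-1 (Ordinal zn))%g.
  rewrite !permKV /=; apply=> //.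
  by apply/andP; split; apply: ltnW; rewrite rE !permKV.
have abn := E_bound Eab; split=> // i j k ijk pi pk.
have [||| conv _] := posE a b; try lia.
have [ij|ij] := eqVneq i j; first by rewrite -ij.
have [jk|jk] := eqVneq j k; first by rewrite jk.
apply: (conv Eab (p i) (p j) (p k)) => //; first by rewrite ltn_ord.
by rewrite -(rE i j) -(rE j k) !ltn_neqAle; move: ij jk; rewrite -!val_eqE /=; lia.
Qed.

End Realisation.

(** * Sides and regions of a polygon *)

Section Polygon.
Variable N : nat.
Implicit Types (F e d : {set 'I_N}) (x y z w u v i j : 'I_N).

Lemma pair_setP e : reflect (exists x y, x < y /\ e = [set x; y]) (#|e| == 2).
Proof.
apply: (iffP (cards2P e)) => [[x [y [xy ->]]]|[x [y [xy ->]]]].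
  move: xy; rewrite -val_eqE neq_ltn => /orP[xy|yx]; first by exists x, y.
  by exists y, x; rewrite setUC.
by exists x, y; split=> //; rewrite -val_eqE neq_ltn xy.
Qed.

Lemma pair_set_inj x y z w : x < y -> z < w -> [set x; y] = [set z; w] -> x = z /\ y = w.
Proof.
move=> xy zw /setP eq_xyzw; have := eq_xyzw x; have := eq_xyzw y.
have := eq_xyzw z; have := eq_xyzw w; rewrite !inE !eqxx ?orbT /= -!val_eqE /=.
by move=> *; split; apply: val_inj => /=; lia.
Qed.

Lemma separatesP x y F : x < y ->
  reflect (exists u v, [/\ u \in F, v \in F, x < u < y & (v < x) || (y < v)])
          (separates [set x; y] F).
Proof.
move=> xy; apply: (iffP exists_inP).
  case=> i; rewrite !inE => ixy /exists_inP[j]; rewrite !inE => jxy.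
  case/exists_inP=> u uF /exists_inP[v vF /andP[iuj vij]]; exists u, v.
  have ij : i < j by lia.
  have [ix jy] : i = x /\ j = y.
    case/orP: ixy ij => /eqP->; case/orP: jxy => /eqP-> //; lia.
  by rewrite -ix -jy.
case=> u [v [uF vF xuy vxy]]; exists x; first by rewrite !inE eqxx.
apply/exists_inP; exists y; first by rewrite !inE eqxx orbT.
by apply/exists_inP; exists u => //; apply/exists_inP; exists v; rewrite ?xuy.
Qed.

(** The alternatives are the consecutive pairs of [F] and the pair of its least and greatest vertex,
    which closes the polygon. *)
Lemma sidesP x y F : x < y -> x \in F -> y \in F ->
  reflect ((forall z, z \in F -> ~~ (x < z < y)) \/ (forall z, z \in F -> x <= z <= y))
          ([set x; y] \in sides F).
Proof.
move=> xy xF yF; rewrite inE cards2 -val_eqE neq_ltn xy /=.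
rewrite subUset !sub1set xF yF /=.
apply: (iffP negP) => [nsep|side /(separatesP _ xy)[u [v [uF vF xuy vxy]]]]; last first.
  by case: side => H; [have := H u uF; rewrite xuy | have := H v vF; lia].
case: (boolP [exists u in F, x < u < y]) => [/exists_inP[u uF xuy]|/exists_inPn H].
  right=> v vF; have [//|vxy] := boolP (x <= v <= y); case: nsep.
  by apply/(separatesP _ xy); exists u, v; split=> //; lia.
by left.
Qed.

Lemma sides_pair F e : e \in sides F ->
  exists x y, [/\ x < y, x \in F, y \in F & e = [set x; y]].
Proof.
rewrite inE => /and3P[/pair_setP[x [y [xy ->]]]].
by rewrite subUset !sub1set => /andP[xF yF] _; exists x, y.
Qed.

(* Every side of F joins a vertex to its successor in the cyclic order, and
   the map sending a vertex to the side that starts there is injective. *)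
Lemma card_sides F : 2 < #|F| -> #|sides F| = #|F|.
Proof.
move=> F3; have [x0 x0F] : exists x, x \in F by apply/card_gt0P/(leq_trans _ F3).
(* Either [y] is the next larger vertex of [F], or [x] is the greatest and [y] the least. *)
pose nextb x y := (y \in F) && ([forall z in F, ~~ (x < z < y)] && (x < y)
     || [forall z in F, y <= z <= x]).
have /fin_all_exists[nx nxP] : forall x, exists y, x \in F -> nextb x y.
  move=> x; case: (boolP (x \in F)) => [xF|]; last by exists x.
  case: (boolP [exists y in F, x < y]) => [/exists_inP[y yF xy]|/exists_inPn xmax].
    have := @arg_minnP _ y [pred y in F | x < y] val.
    rewrite /= yF xy => /(_ isT)[z /andP[zF xz] zmin]; exists z => _.
    rewrite /nextb zF xz andbT; apply/orP; left; apply/forall_inP => w wF.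
    by apply/negP => /andP[xw wz]; have := zmin w; rewrite /= wF xw => /(_ isT); lia.
  have [z zF zmin] : exists2 z, z \in F & forall w, w \in F -> z <= w.
    by case: (@arg_minnP _ x0 (mem F) val x0F) => z zF zmin; exists z.
  exists z => _.
  rewrite /nextb zF; apply/orP; right; apply/forall_inP => w wF.
  by rewrite zmin // leqNgt xmax.
have nxF x : x \in F -> nx x \in F by move=> /nxP/andP[].
have third x y : exists2 z, z \in F & (z != x) && (z != y).
  have : F :\: [set x; y] != set0.
    rewrite setD_eq0; apply: contraL F3 => /subset_leq_card.
    by rewrite cards2; case: (x != y); lia.
  by case/set0Pn => z; rewrite !inE negb_or => /andP[? ?]; exists z.
have nx_lt x : x \in F -> x < nx x \/ nx x < x.
  move=> xF; have [z zF] := third x x; rewrite -val_eqE /= => zx.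
  have := nxP x xF => /andP[_ /orP[/andP[_]|/forall_inP H]]; first by left.
  by have := H z zF; right; lia.
have nx_cases x : x \in F ->
    (x < nx x /\ forall z, z \in F -> ~~ (x < z < nx x)) \/
    (nx x < x /\ forall z, z \in F -> nx x <= z <= x).
  move=> xF; have := nxP x xF => /andP[_ /orP[/andP[/forall_inP H lt]|/forall_inP H]].
    by left.
  by right; split=> //; case: (nx_lt x xF) => //; have := H x xF; lia.
have nx_side x : x \in F -> [set x; nx x] \in sides F.
  move=> xF; case: (nx_cases x xF) => -[lt H].
    by apply/sidesP => //; [exact: nxF | left].
  by rewrite setUC; apply/sidesP => //; [exact: nxF | right].
suff -> : sides F = (fun x => [set x; nx x]) @: F.
  (* Two starting points with the same side would be successors of each other, which a third vertex
     excludes. *)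
  apply: card_in_imset => x y xF yF eq_s.
  have [//|neq] := eqVneq x y.
  have [xE yE] : y = nx x /\ x = nx y.
    move/setP: eq_s => eq_s; have := eq_s x; have := eq_s y; rewrite !inE !eqxx /=.
    by rewrite (eq_sym y x) (negPf neq) /= => /eqP yx /esym/eqP xy.
  have [z zF] := third x y; rewrite -!val_eqE /= => zxy.
  have := nx_cases x xF; have := nx_cases y yF; rewrite -xE -yE.
  by move=> [] [lt1 H1] [] [lt2 H2]; have := H1 z zF; have := H2 z zF; lia.
apply/setP => e; apply/idP/imsetP => [eF|[x xF ->]]; last exact: nx_side.
have [x [y [xy xF yF eE]]] := sides_pair eF; subst e.
move: eF => /(sidesP xy xF yF)[] H.
  exists x => //; congr [set _; _]; apply: val_inj => /=.
  have := H _ (nxF x xF); case: (nx_cases x xF) => -[lt Hx].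
    by have := Hx y yF; lia.
  by have := Hx y yF; lia.
exists y => //; rewrite setUC; congr [set _; _]; apply: val_inj => /=.
have := H _ (nxF y yF); case: (nx_cases y yF) => -[lt Hy].
  by have := Hy x xF; lia.
by have := Hy x xF; lia.
Qed.

Lemma sorted_enum F : sorted (fun x y => x < y) (enum F).
Proof.
rewrite /enum_mem; apply: sorted_filter; first by move=> y x z; exact: ltn_trans.
rewrite -enumT -[sorted _ _](@sorted_map _ _ (@nat_of_ord N) ltn) val_enum_ord.
exact: iota_ltn_sorted.
Qed.

Lemma card3_sortedP F : #|F| = 3 -> exists x y z, x < y < z /\ F =i [:: x; y; z].
Proof.
rewrite cardE; have memF x : (x \in enum F) = (x \in F) by rewrite mem_enum.
case: (enum F) (sorted_enum F) memF => [|x [|y [|z []]]] //= /and3P[xy yz _] memF _.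
by exists x, y, z; rewrite xy yz; split=> // w; rewrite memF.
Qed.

Lemma card4_sortedP F : #|F| = 4 ->
  exists x y z w, [/\ x < y, y < z, z < w & F =i [:: x; y; z; w]].
Proof.
rewrite cardE; have memF x : (x \in enum F) = (x \in F) by rewrite mem_enum.
case: (enum F) (sorted_enum F) memF => [|x [|y [|z [|w []]]]] //= /and4P[xy yz zw _] memF _.
by exists x, y, z, w; split=> // v; rewrite memF.
Qed.

(** * Regions with three or four sides *)

Variable D : {set {set 'I_N}}.
Let bd := sides [set: 'I_N] :|: D.

Lemma region3_triangle : has_region_with D 3 ->
  exists x y z, [/\ x < y < z, [set x; y] \in bd, [set y; z] \in bd & [set x; z] \in bd].
Proof.
case/exists_inP=> F /and3P[F3 /subsetP sF _]; rewrite card_sides // => /eqP.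
move=> /card3_sortedP[x [y [z [xyz memF]]]]; exists x, y, z.
have xF : x \in F by rewrite memF !inE eqxx.
have yF : y \in F by rewrite memF !inE eqxx orbT.
have zF : z \in F by rewrite memF !inE eqxx !orbT.
split=> //; apply: sF; apply/sidesP => //; try lia.
- by left=> w; rewrite memF !inE => /or3P[] /eqP->; lia.
- by left=> w; rewrite memF !inE => /or3P[] /eqP->; lia.
- by right=> w; rewrite memF !inE => /or3P[] /eqP->; lia.
Qed.

Lemma region4_quadrilateral : has_region_with D 4 ->
  exists x y z w, [/\ x < y < z, z < w, [set x; y] \in bd, [set y; z] \in bd &
                      [set z; w] \in bd /\ [set x; w] \in bd].
Proof.
case/exists_inP=> F /and3P[F3 /subsetP sF _]; rewrite card_sides // => /eqP.
move=> /card4_sortedP[x [y [z [w [xy yz zw memF]]]]]; exists x, y, z, w.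
have xF : x \in F by rewrite memF !inE eqxx.
have yF : y \in F by rewrite memF !inE eqxx orbT.
have zF : z \in F by rewrite memF !inE eqxx !orbT.
have wF : w \in F by rewrite memF !inE eqxx !orbT.
split; rewrite ?xy //; try split; apply: sF; apply/sidesP => //; try lia.
- by left=> v; rewrite memF !inE => /or4P[] /eqP->; lia.
- by left=> v; rewrite memF !inE => /or4P[] /eqP->; lia.
- by left=> v; rewrite memF !inE => /or4P[] /eqP->; lia.
- by right=> v; rewrite memF !inE => /or4P[] /eqP->; lia.
Qed.

Hypothesis D_noncrossing : noncrossing D.

Lemma noncrossingP x y z w : [set x; y] \in D -> [set z; w] \in D ->
  x < z < y -> y < w -> False.
Proof.
move=> xyD zwD xzy yw; case/andP: D_noncrossing => _ /forall_inP/(_ _ xyD).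
move/forall_inP/(_ _ zwD)/negP; apply; apply/separatesP; first by lia.
by exists z, w; rewrite !inE !eqxx ?orbT xzy yw ?orbT.
Qed.

Lemma bd_noncrossing x y z w : [set x; y] \in bd -> [set z; w] \in bd ->
  x < z < y -> y < w -> False.
Proof.
move=> xyB zwB xzy yw.
have xy : x < y by lia.
have zw : z < w by lia.
move: xyB; rewrite inE => /orP[/sidesP-/(_ xy)|xyD].
  by rewrite !inE => /(_ isT isT) [] H; [have := H z | have := H w]; rewrite inE; lia.
move: zwB; rewrite inE => /orP[/sidesP-/(_ zw)|zwD].
  by rewrite !inE => /(_ isT isT) [] H; [have := H y | have := H x]; rewrite inE; lia.
exact: (noncrossingP xyD zwD).
Qed.

Lemma bd_closed i j s t : [set i; j] \in bd -> [set s; t] \in bd ->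
  i < s < j -> i <= t <= j.
Proof.
move=> ijB stB isj; have := bd_noncrossing ijB stB isj.
move: stB; rewrite setUC => /bd_noncrossing/(_ ijB); lia.
Qed.

Lemma pair_in_diagonals d : d \in D -> exists x y, x < y /\ d = [set x; y].
Proof.
case/andP: D_noncrossing => /subsetP DD _ /DD.
rewrite inE => /andP[/pair_setP[x [y [xy ->]]] _].
by exists x, y.
Qed.

(** Any two vertices of the triangle are joined by a segment of [bd], so an element of [D]
    separating them would cross that segment. *)
Lemma triangle_region x y z : x < y -> y < z ->
  [set x; y] \in bd -> [set y; z] \in bd -> [set x; z] \in bd -> has_region_with D 3.
Proof.
move=> xy yz xyB yzB xzB; pose F := [set x; y; z].
have F3 : #|F| = 3.
  by rewrite /F setUC cardsU1 cards2 !inE -!val_eqE /=; lia.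
apply/exists_inP; exists F; last by rewrite card_sides F3.
have memF u : (u \in F) = [|| u == x, u == y | u == z] by rewrite !inE -!orbA.
apply/and3P; split; first by rewrite F3.
  apply/subsetP => e /sides_pair[u [v [uv uF vF ->]]]; rewrite -/bd.
  by move: uF vF uv; rewrite !memF => /or3P[] /eqP-> /or3P[] /eqP-> uv;
    rewrite ?xyB ?yzB ?xzB //; move: uv xy yz; clear; lia.
apply/forall_inP => d dD; have [i [j [ij dE]]] := pair_in_diagonals dD; subst d.
have ijB : [set i; j] \in bd by rewrite inE dD orbT.
apply/negP => /(separatesP _ ij)[u [v [uF vF iuj vij]]].
have sym s t : [set s; t] \in bd -> [set t; s] \in bd by rewrite setUC.
suff uvB : u = v \/ [set u; v] \in bd.
  case: uvB => [uv|/(bd_closed ijB)/(_ iuj)]; first by subst v; move: iuj vij; clear; lia.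
  by move: vij; clear; lia.
by move: uF vF; rewrite !memF => /or3P[] /eqP-> /or3P[] /eqP->; auto.
Qed.

(** If [bd] contains a diagonal of the quadrilateral, a triangle appears; otherwise the
    quadrilateral itself is a region. *)
Lemma quadrilateral_region x y z w : x < y -> y < z -> z < w ->
  [set x; y] \in bd -> [set y; z] \in bd -> [set z; w] \in bd -> [set x; w] \in bd ->
  has_region_with D 3 || has_region_with D 4.
Proof.
move=> xy yz zw xyB yzB zwB xwB.
case: (boolP ([set x; z] \in bd)) => [xzB|xzB].
  by rewrite (triangle_region xy yz).
case: (boolP ([set y; w] \in bd)) => [ywB|ywB].
  by rewrite (triangle_region yz zw).
apply/orP; right; pose F := [set x; y; z; w].
have memF u : (u \in F) = [|| u == x, u == y, u == z | u == w] by rewrite !inE -!orbA.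
have [xF yF zF wF] : [/\ x \in F, y \in F, z \in F & w \in F].
  by rewrite !memF !eqxx !orbT.
have F4 : #|F| = 4.
  rewrite /F setUC cardsU1 setUC cardsU1 cards2 !inE -!val_eqE /=; lia.
apply/exists_inP; exists F; last by rewrite card_sides F4.
apply/and3P; split; first by rewrite F4.
  apply/subsetP => e eF; have [u [v [uv uF vF eE]]] := sides_pair eF; subst e; rewrite -/bd.
  move: eF => /(sidesP uv uF vF) side.
  move: uF vF uv side; rewrite !memF => /or4P[] /eqP-> /or4P[] /eqP-> uv side; 
    rewrite ?xyB ?yzB ?zwB ?xwB //; try by move: uv xy yz zw; clear; lia.
    case: side => H; [move: (H y yF) | move: (H w wF)]; move: xy yz zw; clear; lia.
  case: side => H; [move: (H z zF) | move: (H x xF)]; move: xy yz zw; clear; lia.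
apply/forall_inP => d dD; have [i [j [ij dE]]] := pair_in_diagonals dD; subst d.
have ijB : [set i; j] \in bd by rewrite inE dD orbT.
apply/negP => /(separatesP _ ij)[u [v [uF vF iuj vij]]].
have sym s t : [set s; t] \in bd -> [set t; s] \in bd by rewrite setUC.
have [yx zy wz wx] := And4 (sym _ _ xyB) (sym _ _ yzB) (sym _ _ zwB) (sym _ _ xwB).
(* A segment [{i, j}] of [D] separating opposite vertices [u] and [v] crosses none of the four
   sides, so it passes through the other two vertices and is a diagonal of the quadrilateral, which
   was assumed absent. *)
have opposite (s t : 'I_N) : s < t -> [set u; s] \in bd -> [set u; t] \in bd ->
    [set s; v] \in bd -> [set t; v] \in bd -> [set s; t] \in bd.
  move=> st us ut /(bd_closed ijB) sv /(bd_closed ijB) tv.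
  have := bd_closed ijB us iuj; have := bd_closed ijB ut iuj => ijt ijs.
  have [-> -> //] : s = i /\ t = j.
  by split; apply: val_inj; move: st sv tv ijs ijt vij; clear; rewrite /=; lia.
suff uvB : u = v \/ [set u; v] \in bd.
  case: uvB => [uv|/(bd_closed ijB)/(_ iuj)]; first by subst v; move: iuj vij; clear; lia.
  by move: vij; clear; lia.
have [xz yw] : x < z /\ y < w by move: xy yz zw; clear; lia.
move: uF vF opposite; rewrite !memF => /or4P[] /eqP-> /or4P[] /eqP-> opp; auto; right.
- by case/negP: ywB; apply: opp.
- by case/negP: xzB; apply: opp.
- by case/negP: ywB; apply: opp.
- by case/negP: xzB; apply: opp.
Qed.

End Polygon.

(** * The correspondence *)

Section Chords.
Variable n : nat.
Hypothesis n_gt0 : 0 < n.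
Implicit Types (x y z w : 'I_n.+1) (p q : 'S_n).

Lemma polygon_sideE x y : x < y ->
  ([set x; y] \in sides [set: 'I_n.+1]) =
  (y == x.+1 :> nat) || ((x == 0 :> nat) && (y == n :> nat)).
Proof.
move=> xy; have ny := ltn_ord y.
apply/(sidesP xy (in_setT _) (in_setT _))/idP => [[] H|].
- have sx : x.+1 < n.+1 by lia.
  by have := H (Ordinal sx) (in_setT _); rewrite /=; lia.
- by have := H ord0 (in_setT _); have := H ord_max (in_setT _); rewrite /=; lia.
- by case/orP=> xyE; [left|right] => z _; have := ltn_ord z; lia.
Qed.

(** Singletons and the whole interval would become polygon sides, so they are filtered out:
    [noncrossing] admits diagonals only. *)
Definition chords (P : {set {set 'I_n}}) : {set {set 'I_n.+1}} :=
  [set e in diagonals n.+1 | [exists x : 'I_n.+1, exists y : 'I_n.+1,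
     [&& x < y, e == [set x; y] & ivset n x y \in P]]].

Lemma mem_chords P x y : x < y ->
  ([set x; y] \in chords P) =
  ([set x; y] \notin sides [set: 'I_n.+1]) && (ivset n x y \in P).
Proof.
move=> xy; rewrite inE inE cards2 -val_eqE neq_ltn xy /=; congr (_ && _).
apply/existsP/idP => [[z /existsP[w /and3P[zw /eqP/(pair_set_inj xy zw)[-> ->]]]] //|xyP].
by exists x; apply/existsP; exists y; rewrite xy eqxx.
Qed.

(** The intervals lost in [chords] are the singletons and the whole one, which every permutation
    has, so adding all sides restores exactly the intervals of [p]. *)
Lemma blk_chords p x y : x < y ->
  ([set x; y] \in sides [set: 'I_n.+1] :|: chords (interval_poset p)) = blk p x y.
Proof.
move=> xy; have yn : y <= n by have := ltn_ord y.
rewrite inE mem_chords //; case: (boolP (_ \in sides _)) => /= [|_]; last first.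
  by rewrite /blk xy yn.
rewrite polygon_sideE // => /orP[/eqP yE|/andP[/eqP-> /eqP->]].
  by rewrite yE blk_leaf // -yE.
by rewrite blk_root.
Qed.

Lemma interval_poset_eq p q : blk p =2 blk q -> interval_poset p = interval_poset q.
Proof.
move=> pq; apply/setP => V; apply/interval_posetP/interval_posetP.
  by move=> [a [b [pab ->]]]; exists a, b; rewrite -pq.
by move=> [a [b [qab ->]]]; exists a, b; rewrite pq.
Qed.

Lemma chords_inj p q : chords (interval_poset p) = chords (interval_poset q) ->
  interval_poset p = interval_poset q.
Proof.
move=> pq; apply: interval_poset_eq => a b.
case: (boolP (a < b <= n)) => [abn|abn]; last by rewrite /blk (negPf abn).
have an : a < n.+1 by lia.
have bn : b < n.+1 by lia.
have xy : Ordinal an < Ordinal bn by rewrite /=; lia.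
by rewrite -(blk_chords p xy) -(blk_chords q xy) pq.
Qed.

Lemma chords_noncrossing p : block_wise_simple p ->
  noncrossing (chords (interval_poset p)).
Proof.
move/block_wise_simple_blkP => nosum.
apply/andP; split; first by apply/subsetP => e; rewrite inE => /andP[].
have chordP e : e \in chords (interval_poset p) ->
    exists x y, [/\ x < y, e = [set x; y] & blk p x y].
  rewrite inE => /andP[_ /existsP[x /existsP[y /and3P[xy /eqP-> xyP]]]].
  by exists x, y; split=> //; rewrite /blk xy xyP -ltnS ltn_ord.
apply/forall_inP => _ /chordP[x [y [xy -> pxy]]].
apply/forall_inP => _ /chordP[z [w [zw -> pzw]]].
apply/negP => /(separatesP _ xy)[u [v [uF vF xuy vxy]]].
move: uF vF; rewrite !inE => /orP[] /eqP uE /orP[] /eqP vE; subst u v.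
- by move: xuy vxy; clear; lia.
- by apply: (blk_laminar nosum pxy pzw); move: xuy vxy zw; clear; lia.
- by apply: (blk_laminar nosum pzw pxy); move: xuy vxy zw; clear; lia.
- by move: xuy vxy; clear; lia.
Qed.

Lemma chords_free p : block_wise_simple p ->
  triangle_quadrilateral_free (chords (interval_poset p)).
Proof.
move/block_wise_simple_blkP => nosum; apply/andP; split; apply/negP.
  move=> /region3_triangle[x [y [z [/andP[xy yz] xyB yzB xzB]]]].
  have xz : x < z by exact: ltn_trans yz.
  by apply: (nosum x y z); rewrite -blk_chords.
move=> /region4_quadrilateral[x [y [z [w [/andP[xy yz] zw xyB yzB [zwB xwB]]]]]].
have xw : x < w by apply: ltn_trans zw; apply: ltn_trans yz.
by apply: (@blk_no_triple _ _ nosum x y z w); rewrite -blk_chords.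
Qed.

(** The diagonals together with all sides form a family [E] that [blk_realised] turns into a
    permutation: the absence of triangles gives [E_no2], that of both shapes [E_no3]. *)
Lemma chords_surj D : noncrossing D -> triangle_quadrilateral_free D ->
  exists2 p : 'S_n, block_wise_simple p & D = chords (interval_poset p).
Proof.
move=> Dnc /andP[no3 no4].
(* The bounds keep [inord] away from its default value. *)
pose E a b := (a < b <= n) && ([set inord a; inord b] \in sides [set: 'I_n.+1] :|: D).
have ordK a b : E a b -> [/\ (@inord n a) = a :> nat, (@inord n b) = b :> nat, a < b <= n
    & [set inord a; inord b] \in sides [set: 'I_n.+1] :|: D].
  by move=> /andP[abn abD]; split=> //; rewrite inordK; lia.
have E_side a b : a < b <= n -> (b == a.+1) || ((a == 0) && (b == n)) -> E a b.
  move=> abn abE; have aE : @inord n a = a :> nat by rewrite inordK; lia.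
  have bE : @inord n b = b :> nat by rewrite inordK; lia.
  by rewrite /E abn inE polygon_sideE aE bE ?abE //; lia.
have E_lam a b c d : E a b -> E c d -> a < c < b -> b < d -> False.
  move=> /ordK[aE bE _ abB] /ordK[cE dE _ cdB] acb bd.
  by apply: (bd_noncrossing Dnc abB cdB); rewrite ?aE ?bE ?cE ?dE.
have E_no2 a b c : E a b -> E b c -> E a c -> False.
  move=> /ordK[aE bE abn abB] /ordK[_ cE bcn bcB] /ordK[_ _ _ acB].
  by apply: (negP no3); apply: (triangle_region Dnc _ _ abB bcB acB); rewrite ?aE ?bE ?cE; lia.
have E_no3 a b c d : E a b -> E b c -> E c d -> E a d -> False.
  move=> /ordK[aE bE abn abB] /ordK[_ cE bcn bcB] /ordK[_ dE cdn cdB] /ordK[_ _ _ adB].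
  have : has_region_with D 3 || has_region_with D 4.
    by apply: (quadrilateral_region Dnc _ _ _ abB bcB cdB adB); rewrite ?aE ?bE ?cE ?dE; lia.
  by rewrite (negPf no3) (negPf no4).
have [|||p pE] := @blk_realised n E _ _ E_lam E_no2 E_no3 _.
- by move=> a b /andP[].
- by move=> i lt_in; apply: E_side; rewrite ?eqxx ?ltnSn.
- by apply: E_side; rewrite ?eqxx ?orbT ?n_gt0 /=.
exists p.
  by apply/block_wise_simple_blkP => a b c; rewrite !pE; exact: E_no2.
apply/setP => e; case: (boolP (e \in diagonals n.+1)) => [|ndiag]; last first.
  rewrite [RHS]inE (negPf ndiag) /=; apply/negP => eD.
  by case/andP: Dnc => /subsetP/(_ _ eD); rewrite (negPf ndiag).
rewrite inE => /andP[/pair_setP[x [y [xy ->]]] nside].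
have := blk_chords p xy; rewrite pE /E xy !inord_val !inE -ltnS ltn_ord /=.
by move: nside; rewrite inE => /negPf->.
Qed.

End Chords.

Theorem theorem3 (n : nat) (hn : 1 <= n) :
  #|[set interval_poset p | p : 'S_n & block_wise_simple p]|
  = #|[set D : {set {set 'I_n.+1}} |
        noncrossing D && triangle_quadrilateral_free D]|.
Proof.
set A := [set interval_poset p | p : 'S_n & block_wise_simple p].
have -> : [set D : {set {set 'I_n.+1}} |
             noncrossing D && triangle_quadrilateral_free D] = @chords n @: A.
  apply/setP => D; rewrite inE; apply/andP/imsetP => [[Dnc Dfree]|[P PA ->]].
    have [p simple_p ->] := chords_surj hn Dnc Dfree.
    by exists (interval_poset p) => //; apply/imsetP; exists p; rewrite ?inE.
  have [p] := imsetP PA; rewrite inE => simple_p ->.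
  by split; [exact: chords_noncrossing | exact: chords_free].
apply/esym/card_in_imset => P Q /imsetP[p _ ->] /imsetP[q _ ->].
exact: chords_inj.
Qed.
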